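(* Let $G$ be a finite group such that $(G,Z(G))$ is a Camina pair and $Z(G) < G'$ (proper containment), and let $p$ be the prime such that $G$ is a $p$-group. Then either $|Z(G)| \le |G:Z(G)|^{1/2}$ or $|Z(G)|\,p^4 \le |G:Z(G)|$. In particular, if $|G:Z(G)| \le p^8$, then $|Z(G)| \le |G:Z(G)|^{1/2}$.
   Context: A pair $(G,N)$ is a Camina pair if $N$ is a normal subgroup of the finite group $G$ with $1 < N < G$ (i.e. $N$ is nontrivial and proper) and every element $g \in G \setminus N$ is conjugate in $G$ to every element of the coset $gN$. If $(G,Z(G))$ is a Camina pair, then $G$ is a (nontrivial) $p$-group for a unique prime $p$; this is the prime $p$ in the statement. Here $Z(G)$ is the center of $G$ and $G'=[G,G]$ is the derived subgroup. *)

(* Defs.v *)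
From mathcomp Require Import all_boot all_order all_algebra.
From mathcomp Require Import all_fingroup all_solvable all_field.

Set Implicit Arguments.
Unset Strict Implicit.
Unset Printing Implicit Defensive.

Import GroupScope.

(* [g ^: G] is the conjugacy class of [g] in [G], so the last clause says that *)
(* every [g] in [G \ N] is [G]-conjugate to each element of the coset [gN].    *)
Definition camina_pair (gT : finGroupType) (G N : {group gT}) : bool :=
  [&& N <| G, [1 gT] \proper N, N \proper G
    & [forall g in G :\: N, g *: N \subset g ^: G]].

(* Main.v *)
Require Import Defs.
From mathcomp Require Import all_boot all_order all_algebra.
From mathcomp Require Import all_fingroup all_solvable all_field.
From mathcomp Require Import all_character zify.

(** Write [Z = 'Z(G)].  For [x] outside [Z] let [K_x] be the preimage of the
    centralizer of [xZ] in [G / Z].  The Camina condition makes [y |-> [x, y]]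
    a map of [K_x] onto [Z], so [|Z| <= |K_x : C(x)|]; as [C(x)] properly
    contains [Z], this gives [|G : K_x| |Z| p <= |G : Z|].  Since [Z < G'],
    some [g = [x, w^-1]] lies outside [Z]; the Hall-Witt identity shows that
    [K_x :&: K_w] centralizes [g], so [|Z| <= |G : C(g)| <= |G : K_x| |G : K_w|].
    With [|Z| = p^n] and [|G : Z| = p^m] this reads [n <= 2 (m - n - 1)], and
    [m] is even because an irreducible character that is nontrivial on [Z] is
    fully ramified over [Z].  When [m < n + 4] this forces [2 n <= m]. *)

Set Implicit Arguments.
Unset Strict Implicit.
Unset Printing Implicit Defensive.

Import GroupScope Num.Theory.

Definition cent_mod (gT : finGroupType) (G N : {group gT}) (x : gT) :=
  (G :&: coset N @*^-1 'C[coset N x])%G.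

Lemma mem_cent_mod (gT : finGroupType) (G N : {group gT}) (x y : gT) :
  N <| G -> x \in G ->
  (y \in cent_mod G N x) = (y \in G) && ([~ x, y] \in N).
Proof.
case/andP=> _ nNG Gx; rewrite inE; case Gy: (y \in G) => //=.
have [nNx nNy] := (subsetP nNG x Gx, subsetP nNG y Gy).
rewrite inE nNy inE; apply/cent1P/idP => [/commute_sym/commgP|Nxy].
  by rewrite -morphR // => /eqP; apply: coset_idr; rewrite groupR.
by apply/commute_sym/commgP; rewrite -morphR //= coset_id.
Qed.

Lemma camina_pairP (gT : finGroupType) (G N : {group gT}) (x z : gT) :
  camina_pair G N -> x \in G -> x \notin N -> z \in N -> x * z \in x ^: G.
Proof.
case/and4P=> _ _ _ /forall_inP cam Gx Nx Nz.
by apply: (subsetP (cam x _)); rewrite ?inE ?Nx // mem_lcoset mulKg.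
Qed.

(** The index is the size of the orbit of [x] under [cent_mod G N x], and this orbit contains
    [x *: N]: if [x * z = x ^ y] with [z] in [N], then [[~ x, y] = z], so [y] lies in
    [cent_mod G N x]. *)
Lemma camina_leq_index (gT : finGroupType) (G N : {group gT}) (x : gT) :
  camina_pair G N -> x \in G -> x \notin N ->
  #|N| <= #|cent_mod G N x : 'C_G[x]|.
Proof.
move=> cam Gx Nx; have /and4P[nsNG _ _ _] := cam.
have -> : #|cent_mod G N x : 'C_G[x]| = #|x ^: cent_mod G N x|.
  rewrite -index_cent1; congr #|_ : _|; apply/setP=> y.
  rewrite [RHS]inE mem_cent_mod // [LHS]inE; case Gy: (y \in G) => //=.
  by rewrite andb_idl // => /cent1P/commute_sym/commgP/eqP->; rewrite group1.
rewrite -(card_lcoset N x); apply/subset_leq_card/subsetP=> _ /lcosetP[z Nz ->].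
have /imsetP[y Gy xzE] := camina_pairP cam Gx Nx Nz.
by rewrite xzE imset_f // mem_cent_mod // Gy commgEl -xzE mulKg.
Qed.

Lemma camina_leq_index_cent (gT : finGroupType) (G N : {group gT}) (x : gT) :
  camina_pair G N -> x \in G -> x \notin N -> #|N| <= #|G : 'C_G[x]|.
Proof.
move=> cam Gx Nx; apply: leq_trans (camina_leq_index cam Gx Nx) _.
rewrite dvdn_leq // ?indexg_gt0 // indexSg ?subsetIl //.
apply/subsetP=> y /setIP[Gy /cent1P/commute_sym/commgP/eqP cxy].
by have /and4P[nsNG _ _ _] := cam; rewrite mem_cent_mod // Gy cxy group1.
Qed.

Lemma camina_center_index_bound (gT : finGroupType) (G : {group gT}) (p : nat) x :
    camina_pair G 'Z(G)%G -> p.-group G -> x \in G -> x \notin 'Z(G) ->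
  (#|G : cent_mod G 'Z(G) x| * #|'Z(G)| * p <= #|G : 'Z(G)|)%N.
Proof.
move=> cam pG Gx Zx; set K := cent_mod G 'Z(G) x.
have sCK : 'C_G[x] \subset K.
  apply/subsetP=> y /setIP[Gy /cent1P/commute_sym/commgP/eqP cxy].
  by rewrite mem_cent_mod ?center_normal // Gy cxy group1.
have sZC : 'Z(G) \subset 'C_G[x].
  by rewrite -cent_set1 setIS // centS // sub1set.
rewrite -(Lagrange_index (subsetIl _ _) sZC).
rewrite -(Lagrange_index (subsetIl _ _) sCK) leq_mul //.
  by rewrite leq_mul // camina_leq_index.
have ltZC: 'Z(G) \proper 'C_G[x].
  by apply/properP; split=> //; exists x; rewrite // inE Gx cent1id.
(* This index is a power of [p], and it is not 1 because [x] lies in ['C_G[x]] but not in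
   ['Z(G)]. *)
have /p_natP[[|k] iE] := pnat_dvd (dvdn_indexg 'C_G[x] 'Z(G))
  (pgroupS (subsetIl G 'C[x]) pG).
  by case/negP: (proper_subn ltZC); rewrite -(index1g sZC iE) subxx.
have [-> // | p_gt0] := posnP p.
by apply: leq_trans (eq_leq (esym iE)); rewrite expnS leq_pmulr ?expn_gt0 ?p_gt0.
Qed.

(** In the Hall-Witt identity for [x], [w], [y], the inner commutators [[~ w, y^-1]] and
    [[~ y, x^-1]] are central, so only a conjugate of [[~ x, w^-1, y]] survives; hence the inverse
    on [w]. *)
Lemma cent_modI_sub_cent1 (gT : finGroupType) (G : {group gT}) (x w : gT) :
  x \in G -> w \in G ->
  cent_mod G 'Z(G) x :&: cent_mod G 'Z(G) w \subset 'C_G[[~ x, w^-1]].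
Proof.
have comm1 z u : z \in 'Z(G) -> u \in G -> [~ z, u] = 1.
  by case/setIP=> _ /centP cGz Gu; apply/eqP/commgP/cGz.
move=> Gx Gw; apply/subsetP=> y /setIP[Kxy Kwy].
have := groupVr Kwy; rewrite mem_cent_mod ?center_normal // => /andP[_ Zwy].
move: Kxy; rewrite mem_cent_mod ?center_normal // => /andP[Gy Zxy].
have Zyx : [~ y, x^-1] \in 'Z(G).
  have Kyx: x \in cent_mod G 'Z(G) y.
    by rewrite mem_cent_mod ?center_normal // Gx -invg_comm groupV.
  by have:= groupVr Kyx; rewrite mem_cent_mod ?center_normal // => /andP[].
have := Hall_Witt_identity x w y.
rewrite (comm1 _ _ Zwy Gx) (comm1 _ _ Zyx Gw) !conj1g !mulg1.
move/eqP; rewrite conjg_eq1 => /commgP cgy.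
by rewrite inE Gy; apply/cent1P/commute_sym.
Qed.

Lemma camina_center_leq_indexM (gT : finGroupType) (G : {group gT}) (x w : gT) :
    camina_pair G 'Z(G)%G -> x \in G -> w \in G -> [~ x, w^-1] \notin 'Z(G) ->
  (#|'Z(G)| <= #|G : cent_mod G 'Z(G) x| * #|G : cent_mod G 'Z(G) w|)%N.
Proof.
move=> cam Gx Gw Zg; have Gg : [~ x, w^-1] \in G by rewrite groupR ?groupV.
apply: leq_trans (camina_leq_index_cent cam Gg Zg) _.
have sKLC := cent_modI_sub_cent1 Gx Gw.
apply: leq_trans (dvdn_leq (indexg_gt0 _ _) (indexgS G sKLC)) _.
set K := cent_mod _ _ x; set L := cent_mod _ _ w.
have sKG : K \subset G by apply: subsetIl.
(* The index of [K :&: L] in [K] counts the cosets of [L] that meet [K]. *)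
rewrite -(Lagrange_index sKG (subsetIl K L)) leq_mul // indexgI.
exact/subset_leq_card/imsetS.
Qed.

Lemma camina_center_index_square (gT : finGroupType) (G : {group gT}) :
  camina_pair G 'Z(G)%G -> exists d, #|G : 'Z(G)| = (d ^ 2)%N.
Proof.
move=> cam; have /and4P[_ /properP[_ [z Zz nt_z]] _ _] := cam.
(* The kernels of the irreducible characters intersect trivially. *)
have [i Kiz]: exists i : Iirr G, z \notin cfker ('chi_i)%R.
  apply/existsP; apply: contraR nt_z; rewrite negb_exists => /forallP Kz.
  by rewrite -(TI_cfker_irr G); apply/bigcapP=> i _; rewrite -[_ \in _]negbK.
have Gz: z \in G by apply: subsetP (center_sub G) z Zz.
have sZ: 'Z(G) \subset 'Z(('chi_i)%R)%CF by rewrite -cap_cfcenter_irr bigcap_inf.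
(* Off the center, [x * z] is conjugate to [x], while [z] acts as a scalar [c]. So [c] times the
   value at [x] equals that value; if it were nonzero, [c] would be 1 and [z] would lie in the
   kernel. *)
have chiZ: ('chi_i \in 'CF(G, 'Z(G)))%R.
  rewrite cfun_onE; apply/subsetP=> x nz_chi_x; apply: contraR Kiz => Zx.
  have Gx: x \in G by apply: contraR nz_chi_x => /cfun0->.
  have /imsetP[y Gy xzE] := camina_pairP cam Gx Zx Zz.
  have := subsetP sZ z Zz.
  rewrite -irrRepr cfker_repr cfcenter_repr !inE in nz_chi_x *.
  case/andP=> _ /is_scalar_mxP[c Chi_z]; rewrite Gz Chi_z mul1mx /=.
  apply/eqP; congr (_%:M)%R; apply: (GRing.mulIf nz_chi_x); rewrite GRing.mul1r.
  rewrite -{2}(cfunJ _ x Gy) -xzE !cfunE Gx groupM // !{1}GRing.mulrb.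
  by rewrite repr_mxM // Chi_z mul_mx_scalar mxtraceZ.
have ZE: 'Z(('chi_i)%R)%CF = 'Z(G).
  apply/eqP; rewrite eqEsubset sZ andbT; apply/subsetP=> x Zx.
  have Gx := subsetP (cfcenter_sub _) x Zx.
  apply: contraLR Zx => Zx; rewrite irr_cfcenterE // (cfun_on0 chiZ Zx).
  by rewrite normr0 eq_sym irr1_neq0.
(* The witness is the degree: [irr1_bound] is an equality for a character vanishing off its
   center. *)
have /natrP[d dE] := Cnat_irr1 i; exists d; apply/eqP.
rewrite -(eqr_nat algC) GRing.natrX -dE -ZE eq_sym irr1_bound.
by rewrite ZE.
Qed.

Theorem theorem4 (gT : finGroupType) (G : {group gT}) (p : nat)
    (camGZ : camina_pair G 'Z(G)%G)
    (ltZG' : 'Z(G) \proper G^`(1))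
    (p_pr : prime p) (pG : p.-group G) :
  ((#|'Z(G)|%:R <= sqrtC (#|G : 'Z(G)|%:R : algC))%R
     \/ #|'Z(G)| * p ^ 4 <= #|G : 'Z(G)|)%N
  /\ (#|G : 'Z(G)| <= p ^ 8 ->
      (#|'Z(G)|%:R <= sqrtC (#|G : 'Z(G)|%:R : algC))%R)%N.
Proof.
have sqrtE a b : (a%:R <= sqrtC (b%:R : algC))%R = (a ^ 2 <= b)%N.
  rewrite -(@ler_pXn2r algC 2) ?nnegrE ?sqrtC_ge0 ?ler0n //.
  by rewrite sqrtCK -GRing.natrX ler_nat.
rewrite !sqrtE.
have [x [w [Gx Gw Zxw]]]: exists x w,
    [/\ x \in G, w \in G & [~ x, w^-1] \notin 'Z(G)].
  have /subsetPn[_ /imset2P[x w Gx Gw ->] Zxw]: ~~ (commg_set G G \subset 'Z(G)).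
    by rewrite -gen_subG; case/andP: ltZG'.
  by exists x, w^-1; rewrite groupV invgK.
have Zx: x \notin 'Z(G).
  apply: contra Zxw => /setIP[_ /centP cGx].
  by have /commgP/eqP-> := cGx w^-1 (groupVr Gw); rewrite group1.
have Zw: w \notin 'Z(G).
  apply: contra Zxw => /setIP[_ /centP cGw].
  by have /commuteV/commgP/eqP-> := commute_sym (cGw x Gx); rewrite group1.
have le_x := camina_center_index_bound camGZ pG Gx Zx.
have le_w := camina_center_index_bound camGZ pG Gw Zw.
have := camina_center_leq_indexM camGZ Gx Gw Zxw.
have [d] := camina_center_index_square camGZ.
have indexE (H : {group gT}) : exists m, #|G : H| = (p ^ m)%N.
  by have /p_natP[m] := pnat_dvd (dvdn_indexg G H) pG; exists m.
move: le_x le_w.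
have [m ->] := indexE 'Z(G); have [a ->] := indexE (cent_mod G 'Z(G) x).
have [b ->] := indexE (cent_mod G 'Z(G) w).
have /p_natP[n ->] := pgroupS (center_sub G) pG.
have p1 := prime_gt1 p_pr.
rewrite -!expnD -!expnSr -!expnM !leq_exp2l // => le_x le_w /(congr1 (logn p)).
(* The bounds are now [a + n + 1 <= m], [b + n + 1 <= m] and [n <= a + b]. With [m < n + 4] they
   allow [m < 2 * n] only for [n = 4], [m = 7], which the evenness of [m] excludes. If [m <= 8],
   then [n + 4 <= m] also yields [2 * n <= m]. *)
rewrite pfactorK // lognX => mE le_n; lia.
Qed.
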